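(* Let $A:\mathcal{D}^*\to\mathbb{C}^m$ be a weak-* continuous linear map which has the RIP on $\mathcal{S}(\Sigma)$ with respect to $\|\cdot\|_{\mathcal H}$ with constant $\gamma\in[0,1)$. Let $\phi:\mathbb{R}^d\to\mathcal{D}^*$ be a parametrization of the cone $\Sigma$ that is weak-* continuous and twice weak-* Gateaux differentiable, with $\Theta=\phi^{-1}(\Sigma)$ open. Suppose that $\|\cdot\|_{\mathcal H}$ satisfies the compatibility assumption (see context). Let $y=Ax_0+e$ with $x_0\in\Sigma$, $e\in\mathbb{C}^m$, let $g(\theta)=\|A\phi(\theta)-y\|_2^2$, and let $\theta^*$ be a global minimizer of $g$ on $\Theta$. Let $\beta_1>0$ be such that: 1. for any $\theta\in\Lambda_{2\beta_1}$, the set $p(\theta,\theta^* )$ consists of a unique element, denoted $\tilde\theta$; 2. the technical assumption (see context) on $\phi$ and on the radius $\beta_1$ is fulfilled with constants $C_{\phi,\theta^*}$, $M_1$, $M_2$; 3. $$\beta_2:=\frac{1-\gamma}{C_{\phi,\theta^*}\sqrt{1+\gamma}}\;\inf_{\theta\in\Lambda_{\beta_1}}\inf_{z\in[\theta,\tilde\theta]}\left(\frac{\|\partial_{\tilde\theta-\theta}\phi(z)\|_{\mathcal H}^2}{\|A\partial^2_{\tilde\theta-\theta}\phi(z)\|_2}\right)-\frac{1}{C_{\phi,\theta^*}\sqrt{1+\gamma}}\|e\|_2>0,$$ where the quotient is read as $+\infty$ when its denominator vanishes. Then $\Lambda_{\min(\beta_1,\beta_2)}$ is a $g$-basin of attraction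 of $\theta^*$.
   Context: Setting. $\mathcal{D}$ is a Banach space, $\mathcal{D}^*$ its dual with the weak-* topology, $\langle\cdot,\cdot\rangle$ the duality product; $A$ has the form $(Ax)_l=\langle x,\alpha_l\rangle$ with $\alpha_l\in\mathcal{D}$, $1\le l\le m$. $\Sigma\subset\mathcal{D}^*$ is a cone ($\lambda x\in\Sigma$ for $x\in\Sigma,\lambda>0$), contained in a Hilbert space $(\mathcal H,\|\cdot\|_{\mathcal H})$ whose vector operations agree with those of $\mathcal{D}^*$ on $\Sigma$. A parametrization of $\Sigma$ is a map $\phi:\mathbb{R}^d\to\mathcal{D}^*$ with $\Sigma\subset\phi(\mathbb{R}^d)$; $\Theta:=\phi^{-1}(\Sigma)$. Weak-* Gateaux differentiability. $\phi$ is weak-* Gateaux differentiable at $\theta$ if there is a linear map $L_\theta:\mathbb{R}^d\to\mathcal{D}^*$ with $(\phi(\theta+hu)-\phi(\theta))/h\to L_\theta u$ weakly-* as $h\to0$, for every $u\in\mathbb{R}^d$; write $\partial_u\phi(\theta)=L_\theta u$. $\phi$ is twice weak-* Gateaux differentiable if it is weak-* Gateaux differentiable and, for every $u$, $\partial_u\phi$ is weak-* Gateaux differentiable; $\partial_u^2\phi=\partial_u\partial_u\phi$. Secants and RIP. $\mathcal{S}(\Sigma)=\Sigma-\Sigma$. The generalized secant set $\overline{\mathcal{S}(\Sigma)}$ consists of all elements of $\mathcal{S}(\Sigma)$ and all $\partial_u\phi(\theta)$ with $\phi(\theta)\in\Sigma$, $u\in\mathbb{R}^d$. $A$ has the RIP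 on $\mathcal{S}(\Sigma)$ with constant $\gamma$ if $(1-\gamma)\|x\|_{\mathcal H}^2\le\|Ax\|_2^2\le(1+\gamma)\|x\|_{\mathcal H}^2$ for all $x\in\mathcal{S}(\Sigma)$. Compatibility assumption. For every $\partial_u\phi(\theta)\in\overline{\mathcal{S}(\Sigma)}$ with $\phi(\theta)\in\Sigma$, $\left\|\frac{\phi(\theta+|h_n|u)-\phi(\theta)}{|h_n|}\right\|_{\mathcal H}$ converges for every real sequence $|h_n|\to0$ to a limit not depending on the sequence; this limit is denoted $\|\partial_u\phi(\theta)\|_{\mathcal H}$. Distance and projection. $d(\theta,\theta^* )=\min\{\|\tilde\theta-\theta\|_2:\tilde\theta\in\Theta,\ \phi(\tilde\theta)=\phi(\theta^* )\}$ for $\theta\in\mathbb{R}^d$; $p(\theta,\theta^* )$ is the set of minimizers $\tilde\theta$; $\Lambda_\beta=\{\theta\in\Theta: d(\theta,\theta^* )<\beta\}$. $[\theta_1,\theta_2]$ is the line segment. Technical assumption on $\phi$ and radius $\beta$ with constants $C_{\phi,\theta^*},M_1,M_2$: (1) every $\theta\in\mathbb{R}^d$ with $d(\theta,\theta^* )<2\beta$ satisfies $\phi(\theta)\in\Sigma$; (2) $C_{\phi,\theta^*}>0$ and $\|\phi(\theta)-\phi(\theta^* )\|_{\mathcal H}\le C_{\phi,\theta^*}d(\theta,\theta^* )$ for all $\theta\in\Lambda_{2\beta}$; (3) $M_1=\sup_{\theta\in\phi^{-1}(\phi(\theta^* ))}\sup_{\|u\|_2=1}\|A\partial_u\phi(\theta)\|_2<+\infty$;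 (4) $M_2=\sup_{\theta\in\Lambda_{2\beta}}\sup_{\|u\|_2=\|v\|_2=1}\|A\partial_v\partial_u\phi(\theta)\|_2<+\infty$. $g$-basin of attraction. A set $\Lambda\subset\mathbb{R}^d$ with $\theta^*\in\Lambda$ is a $g$-basin of attraction of $\theta^*$ if there exists $\tau_0>0$ such that for any $\tau\in(0,\tau_0]$ and any $\theta_0\in\Lambda$, the sequence $\theta_{n+1}=\theta_n-\tau\nabla g(\theta_n)$ satisfies $g(\theta_n)\to g(\theta^* )$. Here $\nabla g=(\partial g/\partial\theta_i)_{1\le i\le d}$ is the Gateaux gradient. *)

(* Defs.v *)
From HB Require Import structures.
From mathcomp Require Import all_boot all_order all_algebra.
From mathcomp Require Import sesquilinear complex.
From mathcomp Require Import all_classical all_reals all_analysis.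
Set Implicit Arguments.
Unset Strict Implicit.
Unset Printing Implicit Defensive.
Import Order.TTheory GRing.Theory Num.Theory.
Import numFieldNormedType.Exports.
Local Open Scope classical_set_scope.
Local Open Scope ring_scope.

(* The topological dual of D (continuous K-linear forms, pointwise operations),
   equipped with the weak-* topology. *)
Section dual_space.
Context {K : numFieldType} (D : normedModType K).

Definition dual_pred : {pred D -> K^o} :=
  mem [set f : D -> K^o | scalar f /\ continuous f].

Fact dual_submod_closed : submod_closed dual_pred.
Proof.
split.
  rewrite inE/=; split; last by move=> x; exact: cst_continuous.
  by move=> a x y; rewrite /= mulr0 addr0.
move=> a f g; rewrite !inE => -[lf cf] [lg cg]; split.
  move=> b x y.
  have E z : (a *: f + g) z = a * f z + g z by [].
  by rewrite !E lf lg mulrDr mulrCA addrACA -mulrDr.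
move=> x; apply: (@continuousD K K^o D (a *: f) g x); last exact: cg.
by apply: (@continuousZ K K^o D (cst a) f x); [exact: cst_continuous|exact: cf].
Qed.

HB.instance Definition _ :=
  GRing.isSubmodClosed.Build K (D -> K^o) dual_pred dual_submod_closed.

Record dual := Dual { pairing :> D -> K^o ; _ : pairing \in dual_pred }.

HB.instance Definition _ := [isSub for pairing].
HB.instance Definition _ := [Choice of dual by <:].
HB.instance Definition _ := [SubChoice_isSubLmodule of dual by <:].
HB.instance Definition _ := isPointed.Build dual 0.
HB.instance Definition _ := Topological.copy dual
  (initial_topology (pairing : dual -> {ptws D -> K^o})).

End dual_space.

(* 'rV and 'cV carry the sup norm in the library; these are the norms || . ||_2. *)
Definition norm2 {R : realType} {d : nat} (u : 'rV[R]_d) : R :=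
  Num.sqrt (\sum_(i < d) u 0 i ^+ 2).

Definition cnorm2 {R : realType} {m : nat} (z : 'cV[R[i]]_m) : R :=
  Num.sqrt (\sum_(i < m) Normc.normc (z i 0) ^+ 2).

Section models.
Context {R : realType} {D : normedModType R[i]} {H : normedModType R}.
Implicit Types (Sigma : set (dual D)) (iota : dual D -> H).

Definition is_cone Sigma : Prop :=
  forall (x : dual D) (a : R), Sigma x -> 0 < a -> Sigma (a%:C%C *: x).

(* A point x of Sigma, seen as an element of H, is iota x.  The values of iota
   matter only on real combinations of two points of Sigma. *)
Definition contained_in_Hilbert Sigma iota : Prop :=
  set_inj Sigma iota /\
  forall x y, Sigma x -> Sigma y -> forall a b : R,
    iota (a%:C%C *: x + b%:C%C *: y) = a *: iota x + b *: iota y.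

Definition secant Sigma : set (dual D) := [set x - y | x in Sigma & y in Sigma].

Definition RIP (m : nat) (A : dual D -> 'cV[R[i]]_m) iota (S : set (dual D))
    (gamma : R) : Prop :=
  forall x, S x ->
    (1 - gamma) * `|iota x| ^+ 2 <= cnorm2 (A x) ^+ 2 <=
    (1 + gamma) * `|iota x| ^+ 2.

End models.

Section weak_star_gateaux.
Context {R : realType} {D : normedModType R[i]} {d : nat}.
Implicit Types (f : 'rV[R]_d -> dual D) (theta u : 'rV[R]_d).

Definition diff_quotient f theta u (h : R) : dual D :=
  (h^-1)%:C%C *: (f (theta + h *: u) - f theta).

Definition ws_differentiable f theta : Prop :=
  exists L : {linear 'rV[R]_d -> dual D | real_complex R \; *:%R},
    forall u, diff_quotient f theta u h @[h --> 0^'] --> L u.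

Definition ws_derive f u theta : dual D :=
  lim (diff_quotient f theta u h @[h --> 0^']).

Definition ws_twice_differentiable f : Prop :=
  (forall theta, ws_differentiable f theta) /\
  forall u theta, ws_differentiable (ws_derive f u) theta.

End weak_star_gateaux.

Section parametrization.
Context {R : realType} {D : normedModType R[i]} {H : normedModType R}.
Context {d m : nat}.
Variables (A : dual D -> 'cV[R[i]]_m) (Sigma : set (dual D)) (iota : dual D -> H).
Variable phi : 'rV[R]_d -> dual D.
Implicit Types (theta u z : 'rV[R]_d) (r : \bar R).

Definition parametrizes : Prop := Sigma `<=` range phi.

Definition Theta : set 'rV[R]_d := phi @^-1` Sigma.

Definition is_deriv_normH theta u (l : R) : Prop :=
  forall h : R^nat, (forall n, h n != 0) -> `|h n| @[n --> \oo] --> (0 : R) ->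
    `|iota (diff_quotient phi theta u `|h n|)| @[n --> \oo] --> l.

Definition compatible_normH : Prop :=
  forall theta u, Sigma (phi theta) -> exists l, is_deriv_normH theta u l.

(* || \partial_u phi(theta) ||_H *)
Definition deriv_normH theta u : R := get [set l | is_deriv_normH theta u l].

Variable thetas : 'rV[R]_d.

Definition fiber : set 'rV[R]_d :=
  [set t | Theta t /\ phi t = phi thetas].

(* d(theta, theta^* ), as an infimum: it is attained when phi is weak-*
   continuous, the fiber being then closed. *)
Definition fiber_dist theta : R := inf [set norm2 (t - theta) | t in fiber].

Definition fiber_proj theta : set 'rV[R]_d :=
  [set t | fiber t /\ forall t', fiber t' -> norm2 (t - theta) <= norm2 (t' - theta)].

Definition Lambda r : set 'rV[R]_d :=
  [set theta | Theta theta /\ ((fiber_dist theta)%:E < r)%E].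

Definition technical_assumption (beta C : R) (M1 M2 : \bar R) : Prop :=
  [/\ forall theta, fiber_dist theta < 2 * beta -> Sigma (phi theta),
      0 < C /\ (forall theta, Lambda (2 * beta)%:E theta ->
        `|iota (phi theta - phi thetas)| <= C * fiber_dist theta),
      M1 = ereal_sup [set ereal_sup
          [set (cnorm2 (A (ws_derive phi u theta)))%:E | u in [set u | norm2 u = 1]]
        | theta in phi @^-1` [set phi thetas]] /\ (M1 < +oo)%E &
      M2 = ereal_sup [set ereal_sup
          [set (cnorm2 (A (ws_derive (ws_derive phi uv.1) uv.2 theta)))%:E
            | uv in [set uv | norm2 uv.1 = 1 /\ norm2 uv.2 = 1]]
        | theta in Lambda (2 * beta)%:E] /\ (M2 < +oo)%E].

Definition line_segment (x y : 'rV[R]_d) : set 'rV[R]_d :=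
  [set (1 - t) *: x + t *: y | t in `[0, 1]].

Definition curvature_ratio z u : \bar R :=
  let q := cnorm2 (A (ws_derive (ws_derive phi u) u z)) in
  if q == 0 then +oo%E else (deriv_normH z u ^+ 2 / q)%:E.

(* ptilde theta stands for the element of fiber_proj theta. *)
Definition inf_curvature (beta : R) (ptilde : 'rV[R]_d -> 'rV[R]_d) : \bar R :=
  ereal_inf [set ereal_inf
      [set curvature_ratio z (ptilde theta - theta)
        | z in line_segment theta (ptilde theta)]
    | theta in Lambda beta%:E].

End parametrization.

Section descent.
Context {R : realType} {d : nat}.
Variable g : 'rV[R]_d -> R.

Definition grad (theta : 'rV[R]_d) : 'rV[R]_d := \row_(i < d) 'D_('e_i) g theta.

Definition gradient_descent (tau : R) (theta0 : 'rV[R]_d) (n : nat) : 'rV[R]_d :=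
  iter n (fun theta => theta - tau *: grad theta) theta0.

Definition basin_of_attraction (L : set 'rV[R]_d) (thetas : 'rV[R]_d) : Prop :=
  L thetas /\
  exists2 tau0 : R, 0 < tau0 &
    forall tau, 0 < tau <= tau0 -> forall theta0, L theta0 ->
      g (gradient_descent tau theta0 n) @[n --> \oo] --> g thetas.

Definition is_global_min (T : set 'rV[R]_d) (thetas : 'rV[R]_d) : Prop :=
  T thetas /\ forall theta, T theta -> g thetas <= g theta.

End descent.

(* Main.v *)
(** For theta close to the fiber of thetas, let u be the vector from theta to
    its projection.  The RIP, the bound on the residual and the definition of
    beta2 make the second derivative of g along u nonnegative on the whole
    segment, so the convexity inequality reads
      <grad g(theta), u> <= g(thetas) - g(theta).
    The bounds M1 and M2 make g smooth on a tube on which g >= g(thetas), whence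
    |grad g|^2 <= K (g - g(thetas)).  With these two inequalities a gradient step
    of size tau <= 1/K decreases the squared distance to the projection by at
    least tau (g(theta) - g(thetas)): the iterates stay in the tube and the
    excesses g - g(thetas) are summable. *)
Require Import Defs.
From mathcomp Require Import all_boot all_order all_algebra.
From mathcomp Require Import sesquilinear complex.
From mathcomp Require Import all_classical all_reals all_analysis.
From mathcomp Require Import ring lra.
Set Implicit Arguments.
Unset Strict Implicit.
Unset Printing Implicit Defensive.
Import Order.TTheory GRing.Theory Num.Theory.
Import numFieldNormedType.Exports.
Local Open Scope classical_set_scope.
Local Open Scope ring_scope.

(** * Euclidean norms of finite families and the Cauchy-Schwarz inequality *)

Section euclidean_norm.
Context {R : realType} {I : finType}.
Implicit Types a b : I -> R.

(** The index is an arbitrary finite type, so as to cover row vectors as well as the real and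
    imaginary parts of complex columns. *)
Definition l2norm a : R := Num.sqrt (\sum_i a i ^+ 2).

Lemma sum_sqr_ge0 a : 0 <= \sum_i a i ^+ 2.
Proof. by apply: sumr_ge0 => i _; exact: sqr_ge0. Qed.

Lemma l2norm_ge0 a : 0 <= l2norm a.
Proof. exact: sqrtr_ge0. Qed.

Lemma sqr_l2norm a : l2norm a ^+ 2 = \sum_i a i ^+ 2.
Proof. by rewrite sqr_sqrtr// sum_sqr_ge0. Qed.

Lemma l2norm_eq0 a : l2norm a = 0 -> forall i, a i = 0.
Proof.
move=> a0 i; have := sqr_l2norm a; rewrite a0 expr0n/= => /esym/eqP.
rewrite psumr_eq0; last by move=> j _; exact: sqr_ge0.
by move=> /allP/(_ i (mem_index_enum i)); rewrite sqrf_eq0 => /eqP.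
Qed.

Lemma l2normZ c a : l2norm (fun i => c * a i) = `|c| * l2norm a.
Proof.
rewrite /l2norm -sqrtr_sqr -sqrtrM ?sqr_ge0//; congr Num.sqrt.
by rewrite mulr_sumr; apply: eq_bigr => i _; rewrite exprMn.
Qed.

Lemma cauchy_schwarz a b : \sum_i a i * b i <= l2norm a * l2norm b.
Proof.
rewrite -sqrtrM ?sum_sqr_ge0//; apply: le_trans (ler_norm _) _.
rewrite -sqrtr_sqr; apply: ler_wsqrtr.
(* Lagrange's identity *)
suff E : \sum_i \sum_j (a i * b j - a j * b i) ^+ 2 =
    2 * ((\sum_i a i ^+ 2) * (\sum_i b i ^+ 2) - (\sum_i a i * b i) ^+ 2).
  have : 0 <= \sum_i \sum_j (a i * b j - a j * b i) ^+ 2.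
    by apply: sumr_ge0 => i _; apply: sumr_ge0 => j _; exact: sqr_ge0.
  by rewrite E pmulr_rge0// subr_ge0.
have E1 : \sum_i \sum_j a i ^+ 2 * b j ^+ 2 =
    (\sum_i a i ^+ 2) * (\sum_i b i ^+ 2).
  by rewrite mulr_suml; apply: eq_bigr => i _; rewrite mulr_sumr.
have E2 : \sum_i \sum_j (a i * b i) * (a j * b j) = (\sum_i a i * b i) ^+ 2.
  by rewrite expr2 mulr_suml; apply: eq_bigr => i _; rewrite mulr_sumr.
have E3 : \sum_i \sum_j a j ^+ 2 * b i ^+ 2 =
    (\sum_i a i ^+ 2) * (\sum_i b i ^+ 2) by rewrite exchange_big.
have -> : forall x y : R, 2 * (x - y) = x + x - 2 * y by move=> x y; ring.
rewrite -[X in _ + X - _]E3 -[X in X + _ - _]E1 -E2 mulr_sumr -big_split/=.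
rewrite -sumrB; apply: eq_bigr => i _.
rewrite mulr_sumr -big_split/= -sumrB; apply: eq_bigr => j _.
by ring.
Qed.

Lemma cauchy_schwarzN a b : - (l2norm a * l2norm b) <= \sum_i a i * b i.
Proof.
rewrite lerNl -sumrN; have := cauchy_schwarz (fun i => -1 * a i) b.
rewrite l2normZ normrN1 mul1r; apply: le_trans.
by rewrite le_eqVlt; apply/orP; left; apply/eqP/eq_bigr => i _; ring.
Qed.

Lemma l2norm_triangle a b : l2norm (fun i => a i + b i) <= l2norm a + l2norm b.
Proof.
rewrite -ler_sqr ?nnegrE ?addr_ge0 ?l2norm_ge0//.
rewrite sqrrD !sqr_l2norm.
have -> : \sum_i (a i + b i) ^+ 2 =
    \sum_i a i ^+ 2 + (\sum_i a i * b i) *+ 2 + \sum_i b i ^+ 2.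
  rewrite -sumrMnl -!big_split/=.
  by apply: eq_bigr => i _; ring.
by rewrite lerD2r lerD2l lerMn2r/= cauchy_schwarz.
Qed.

End euclidean_norm.

Section norm2_theory.
Context {R : realType} {d : nat}.
Implicit Types u v : 'rV[R]_d.

Definition dotrv u v : R := \sum_i u 0 i * v 0 i.

Lemma norm2_ge0 u : 0 <= norm2 u.
Proof. exact: l2norm_ge0. Qed.

Lemma norm2Z (c : R) u : norm2 (c *: u) = `|c| * norm2 u.
Proof.
rewrite -[RHS](l2normZ c (u 0)); congr Num.sqrt.
by apply: eq_bigr => i _; rewrite mxE.
Qed.

Lemma norm2_eq0 u : norm2 u = 0 -> u = 0.
Proof. by move=> /l2norm_eq0 u0; apply/rowP => i; rewrite u0 mxE. Qed.

Lemma norm20 : norm2 (0 : 'rV[R]_d) = 0.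
Proof. by rewrite -(scale0r 0) norm2Z normr0 mul0r. Qed.

Lemma norm2N u : norm2 (- u) = norm2 u.
Proof. by rewrite -scaleN1r norm2Z normrN1 mul1r. Qed.

Lemma ler_norm2D u v : norm2 (u + v) <= norm2 u + norm2 v.
Proof.
apply: le_trans (l2norm_triangle (u 0) (v 0)).
by rewrite le_eqVlt; apply/orP; left; apply/eqP; congr Num.sqrt;
  apply: eq_bigr => i _; rewrite mxE.
Qed.

Lemma dotrvv u : dotrv u u = norm2 u ^+ 2.
Proof. by rewrite [RHS]sqr_l2norm; apply: eq_bigr => i _; rewrite expr2. Qed.

Lemma sqr_norm2D u v :
  norm2 (u + v) ^+ 2 = norm2 u ^+ 2 + 2 * dotrv u v + norm2 v ^+ 2.
Proof.
rewrite -!dotrvv /dotrv mulr_sumr -!big_split/=.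
by apply: eq_bigr => i _; rewrite !mxE; ring.
Qed.

Lemma dotrvZr (c : R) u v : dotrv u (c *: v) = c * dotrv u v.
Proof. by rewrite mulr_sumr; apply: eq_bigr => i _; rewrite !mxE; ring. Qed.

End norm2_theory.

(** * Mean value estimates on the real line *)

Section real_line.
Context {R : realType}.

Lemma is_derive_sum_fin (I : finType) (h : I -> R -> R) (dh : I -> R) (x : R) :
  (forall i, is_derive x 1 (h i) (dh i)) ->
  is_derive x 1 (fun t => \sum_i h i t) (\sum_i dh i).
Proof.
move=> hd; elim: (index_enum I) => [|i r IH].
  under eq_fun do rewrite big_nil.
  by rewrite big_nil; exact: is_derive_cst.
under eq_fun do rewrite big_cons.
by rewrite big_cons; exact: is_deriveD.
Qed.

Lemma mean_value (f df : R -> R) :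
  (forall t : R, is_derive t (1 : R) f (df t)) ->
  forall b, 0 < b -> exists2 c, 0 < c < b & f b - f 0 = df c * b.
Proof.
move=> fd b b0.
have [|c + E] := @MVT R f df 0 b b0 (fun x _ => fd x).
  apply: derivable_within_continuous => x _.
  by have [] := fd x.
by rewrite in_itv/= => cb; exists c => //; rewrite E subr0.
Qed.

(** Two uses of the mean value theorem give [k 1 - k 0 = k1 c] and [k1 c - k1 0 = k2 b * c] with
    [0 < b < c < 1]. *)
Lemma convex_above_tangent (k k1 k2 : R -> R) :
  (forall t : R, is_derive t (1 : R) k (k1 t)) ->
  (forall t : R, is_derive t (1 : R) k1 (k2 t)) ->
  (forall t, 0 <= t <= 1 -> 0 <= k2 t) -> k 0 + k1 0 <= k 1.
Proof.
move=> kd k1d k2_ge0; rewrite -lerBrDl.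
have [c /andP[c0 c1] ->] := mean_value kd ltr01.
have [b /andP[b0 bc] E] := mean_value k1d c0.
rewrite mulr1 -subr_ge0 E mulr_ge0 ?(ltW c0)// k2_ge0//.
by rewrite (ltW b0) ltW// (lt_trans bc).
Qed.

(** The function [M / 2 * t ^+ 2 - k t] has a nonnegative second derivative on the unit interval,
    hence lies above its tangent at 0. *)
Lemma quadratic_upper_bound (k k1 k2 : R -> R) (M : R) :
  (forall t : R, is_derive t (1 : R) k (k1 t)) ->
  (forall t : R, is_derive t (1 : R) k1 (k2 t)) ->
  (forall t, 0 <= t <= 1 -> k2 t <= M) -> k 1 <= k 0 + k1 0 + M / 2.
Proof.
move=> kd k1d k2M.
have := @convex_above_tangent (fun t => M / 2 * t ^+ 2 - k t)
  (fun t => M * t - k1 t) (fun t => M - k2 t).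
rewrite expr0n/= expr1n !mulr0 !sub0r mulr1 => H.
suff: - k 0 - k1 0 <= M / 2 - k 1 by lra.
apply: H => [t|t|t t01]; last by rewrite subr_ge0 k2M.
- apply: is_deriveB.
  have -> : M * t = M / 2 * (2 * t) by field.
  have /(is_deriveZ (M / 2)) := is_deriveX 2 (is_derive_id t (1 : R)).
  by rewrite /= expr1 scaler1.
- apply: is_deriveB.
  by have /(is_deriveZ M) := is_derive_id t (1 : R); rewrite scaler1.
Qed.

(** Mean value inequality for vector-valued functions. Pairing with the increment [c] itself reduces
    it to the scalar case; Cauchy-Schwarz then lets one factor [l2norm c] cancel. *)
Lemma l2norm_increment (I : finType) (w dw : I -> R -> R) (b M : R) : 0 < b ->
  (forall i (t : R), is_derive t (1 : R) (w i) (dw i t)) ->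
  (forall t, 0 < t < b -> l2norm (dw^~ t) <= M) ->
  l2norm (fun i => w i b - w i 0) <= M * b.
Proof.
move=> b0 wd dwM; pose c i := w i b - w i 0.
have sd (t : R) : is_derive t (1 : R) (fun t => \sum_i c i * w i t)
    (\sum_i c i * dw i t).
  exact: (@is_derive_sum_fin _ (fun i t => c i * w i t)
    (fun i => c i * dw i t)).
have [t tb E] := mean_value sd b0.
(* A zero increment is set apart because [l2norm c] is cancelled below; there the bound on [dw] at
   [t] supplies [0 <= M]. *)
rewrite -/c; have := l2norm_ge0 c; rewrite le_eqVlt => /orP[/eqP <-|c0].
  by rewrite mulr_ge0 ?(ltW b0)//; apply: le_trans (dwM t tb); exact: l2norm_ge0.
have {}E : l2norm c ^+ 2 = (\sum_i c i * dw i t) * b.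
  rewrite -E sqr_l2norm -sumrB; apply: eq_bigr => i _.
  by rewrite -mulrBr expr2.
rewrite -(ler_pM2l c0) -expr2 E mulrA ler_pM2r//.
apply: le_trans (cauchy_schwarz _ _) _.
by rewrite ler_pM2l// dwM.
Qed.

(** [D] is nonincreasing and bounded below, hence convergent, so the upper bound [D n - D n.+1] of
    [a n] tends to 0. *)
Lemma summable_decrease_cvg (a D : R^nat) :
  (forall n, 0 <= a n) -> (forall n, 0 <= D n) ->
  (forall n, D n.+1 <= D n - a n) -> a @ \oo --> (0 : R).
Proof.
move=> a0 D0 Da.
have Dcvg : cvgn D.
  apply: nonincreasing_is_cvgn.
    apply/nonincreasing_seqP => n; apply: le_trans (Da n) _.
    by rewrite gerBl.
  by exists 0 => _ [n _ <-].
apply: (@squeeze_cvgr _ _ _ _ (fun=> 0) (fun n => D n - D n.+1)).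
- by near=> n; rewrite a0/= lerBrDr addrC -lerBrDr Da.
- exact: cvg_cst.
- rewrite -(subrr (limn D)); apply: cvgB => //.
  by rewrite (cvg_shiftS D).
Unshelve. all: by end_near. Qed.

End real_line.

(** * Gradient descent under a convexity inequality and a gradient bound *)

Section gradient_descent_convergence.
Context {R : realType} {d : nat}.
Implicit Types (g : 'rV[R]_d -> R) (theta : 'rV[R]_d).

Lemma derive_line g theta u (l : R) :
  is_derive (0 : R) (1 : R) (fun t => g (theta + t *: u)) l ->
  'D_u g theta = l.
Proof.
move=> [_ <-]; rewrite /derive.
set f := (X in lim (fmap X _) = _); set f' := (X in _ = lim (fmap X _)).
suff -> : f = f' by [].
apply/funext => h; rewrite /f /f'/=.
by rewrite scale0r !addr0 [h *: u + _]addrC [h *: 1]mulr1.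
Qed.

(** [grad] records partial derivatives only; linearity of the derivative in its direction recovers
    all other directions. *)
Lemma dotrv_grad g theta (l : 'rV[R]_d -> R) :
  (forall (a : R) u v, l (a *: u + v) = a * l u + l v) ->
  (forall u, is_derive (0 : R) (1 : R) (fun t => g (theta + t *: u)) (l u)) ->
  forall u, dotrv u (grad g theta) = l u.
Proof.
move=> llin gd u; rewrite {2}(row_sum_delta u).
have l0 : l 0 = 0.
  by have := llin (-1) 0 0; rewrite scaler0 addr0; lra.
have E (r : seq 'I_d) : l (\sum_(i <- r) u 0 i *: 'e_i) =
    \sum_(i <- r) u 0 i * l 'e_i.
  elim: r => [|i r IH]; first by rewrite !big_nil.
  by rewrite !big_cons llin IH.
by rewrite E; apply: eq_bigr => i _; rewrite mxE (derive_line (gd _)).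
Qed.

(** The trial step [- s *: grad g theta] has norm at most [r] since [s * M <= r]. With [N] the
    squared norm of the gradient, the quadratic bound there and [s * L <= 1] give
    [gm <= g theta - s * N / 2]. *)
Lemma sqr_norm2_grad_le g theta (gm r L M s : R) : 0 < s ->
  (forall v, norm2 v <= r -> gm <= g (theta + v) /\
    g (theta + v) <= g theta + dotrv v (grad g theta) + L * norm2 v ^+ 2 / 2) ->
  norm2 (grad g theta) <= M -> s * M <= r -> s * L <= 1 ->
  norm2 (grad g theta) ^+ 2 <= 2 / s * (g theta - gm).
Proof.
move=> s0 gv gM sM sL; set N := norm2 (grad g theta) ^+ 2.
have := gv ((- s) *: grad g theta).
rewrite norm2Z normrN (gtr0_norm s0) => /(_ _)[|gm1 gm2].
  by apply: le_trans sM; rewrite ler_pM2l.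
have N0 : 0 <= N by exact: sqr_ge0.
have : s * N <= 2 * (g theta - gm).
  have {gm1} := le_trans gm1 gm2.
  have -> : dotrv (- s *: grad g theta) (grad g theta) = - s * N.
    by rewrite /N -dotrvv -dotrvZr /dotrv; apply: eq_bigr => i _; rewrite mulrC.
  rewrite exprMn -/N => H.
  have : s * L * (s * N) <= 1 * (s * N) by rewrite ler_wpM2r// mulr_ge0// ltW.
  by lra.
by move=> H; rewrite -mulrAC ler_pdivlMr// mulrC.
Qed.

(** When the squared distance from the new iterate to [pt theta] is expanded, the cross term is at
    most [- 2 * tau * (g theta - gm)] and the square of the step at most [tau * (g theta - gm)],
    because [tau * K <= 1]. By the last hypothesis on [P], a point no farther from [pt theta]
    remains in [P], and its own reference point is at least as close; hence the decreases
    telescope. *)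
Lemma gradient_descent_cvg g (pt : 'rV[R]_d -> 'rV[R]_d) (P : set 'rV[R]_d)
    (gm K : R) : 0 < K ->
  (forall theta, P theta -> gm <= g theta) ->
  (forall theta, P theta ->
    dotrv (pt theta - theta) (grad g theta) <= gm - g theta) ->
  (forall theta, P theta -> norm2 (grad g theta) ^+ 2 <= K * (g theta - gm)) ->
  (forall theta theta', P theta ->
    norm2 (pt theta - theta') <= norm2 (pt theta - theta) ->
    P theta' /\ norm2 (pt theta' - theta') <= norm2 (pt theta - theta')) ->
  forall tau, 0 < tau <= K^-1 -> forall theta0, P theta0 ->
    g (gradient_descent g tau theta0 n) @[n --> \oo] --> gm.
Proof.
move=> K0 gm_le gconv ggrad Pstep tau /andP[tau0 tauK] theta0 P0.
have decr theta : P theta ->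
    norm2 (pt theta - (theta - tau *: grad g theta)) ^+ 2 <=
    norm2 (pt theta - theta) ^+ 2 - tau * (g theta - gm).
  move=> Pt; rewrite opprB addrCA [X in norm2 X]addrC.
  rewrite [leLHS]sqr_norm2D dotrvZr norm2Z exprMn (gtr0_norm tau0).
  have H1 := gconv _ Pt; have H2 := ggrad _ Pt.
  have gm0 : 0 <= g theta - gm by rewrite subr_ge0 gm_le.
  have {}H1 : tau * dotrv (pt theta - theta) (grad g theta) <=
    tau * (gm - g theta) by rewrite ler_pM2l.
  have {}H2 : tau ^+ 2 * norm2 (grad g theta) ^+ 2 <=
    tau * (tau * K * (g theta - gm)).
    by rewrite expr2 -mulrA ler_pM2l// -mulrA ler_pM2l.
  have H3 : tau * (tau * K * (g theta - gm)) <= tau * (1 * (g theta - gm)).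
    rewrite ler_pM2l// ler_wpM2r//.
    by rewrite -(mulVf (lt0r_neq0 K0)) ler_pM2r.
  by lra.
set x := gradient_descent g tau theta0.
have xS n : x n.+1 = x n - tau *: grad g (x n) by [].
have step n : P (x n) -> P (x n.+1) /\
    norm2 (pt (x n.+1) - x n.+1) <= norm2 (pt (x n) - x n.+1).
  move=> Px; apply: Pstep => //.
  rewrite -ler_sqr ?nnegrE ?norm2_ge0// xS; apply: le_trans (decr _ Px) _.
  by rewrite gerBl mulr_ge0 ?(ltW tau0)// subr_ge0 gm_le.
have Px n : P (x n) by elim: n => [//|n /step[]].
have cvg0 : (fun n => tau * (g (x n) - gm)) @ \oo --> (0 : R).
  apply: (@summable_decrease_cvg _ _ (fun n => norm2 (pt (x n) - x n) ^+ 2)).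
  - by move=> n; rewrite mulr_ge0 ?(ltW tau0)// subr_ge0 gm_le.
  - by move=> n; exact: sqr_ge0.
  - move=> n; apply: le_trans (decr _ (Px n)); rewrite -xS.
    by rewrite ler_sqr ?nnegrE ?norm2_ge0//; have [] := step n (Px n).
have -> : (fun n => g (x n)) =
    (fun n => tau^-1 * (tau * (g (x n) - gm)) + gm).
  by apply/funext => n; rewrite mulKf ?lt0r_neq0// subrK.
rewrite -[X in _ --> X]add0r -[X in _ --> X + _](mulr0 tau^-1).
by apply: cvgD; [apply: cvgMr|exact: cvg_cst].
Qed.

End gradient_descent_convergence.

(** * Sums of squares: derivatives along lines and bounds on balls *)

Section least_squares.
Context {R : realType} {d : nat} {I : finType}.
Context (F : I -> 'rV[R]_d -> R) (F1 : I -> 'rV[R]_d -> 'rV[R]_d -> R).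
Context (F2 : I -> 'rV[R]_d -> 'rV[R]_d -> 'rV[R]_d -> R).
Implicit Types theta u v z : 'rV[R]_d.
Context (FD : forall i theta u (t : R), is_derive t (1 : R)
  (fun s => F i (theta + s *: u)) (F1 i u (theta + t *: u))).
Context (F1D : forall i u theta v (t : R), is_derive t (1 : R)
  (fun s => F1 i u (theta + s *: v)) (F2 i u v (theta + t *: v))).
Context (F1lin : forall i theta (a : R) u v,
  F1 i (a *: u + v) theta = a * F1 i u theta + F1 i v theta).

Let g theta := \sum_i F i theta ^+ 2.
Let dg u theta := 2 * \sum_i F i theta * F1 i u theta.
Let ddg u theta := 2 * \sum_i (F1 i u theta ^+ 2 + F i theta * F2 i u u theta).

Lemma lsq_is_derive theta u (t : R) :
  is_derive t (1 : R) (fun s => g (theta + s *: u)) (dg u (theta + t *: u)).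
Proof.
rewrite /dg mulr_sumr; apply: (@is_derive_sum_fin _ _
  (fun i s => F i (theta + s *: u) ^+ 2)
  (fun i => 2 * (F i (theta + t *: u) * F1 i u (theta + t *: u)))) => i.
have := is_deriveX 2 (FD i theta u t).
by rewrite /= expr1 /GRing.scale/= mulrA.
Qed.

Lemma lsq_is_derive2 theta u (t : R) :
  is_derive t (1 : R) (fun s => dg u (theta + s *: u)) (ddg u (theta + t *: u)).
Proof.
apply: (is_deriveZ 2); apply: (@is_derive_sum_fin _ _
  (fun i s => F i (theta + s *: u) * F1 i u (theta + s *: u))
  (fun i => F1 i u (theta + t *: u) ^+ 2 +
            F i (theta + t *: u) * F2 i u u (theta + t *: u))) => i.
have := is_deriveM (FD i theta u t) (F1D i u theta u t).
by rewrite /GRing.scale/= expr2 addrC.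
Qed.

Lemma lsq_dotrv_grad theta u : dotrv u (grad g theta) = dg u theta.
Proof.
apply: (dotrv_grad (l := dg^~ theta)).
- move=> a v w; rewrite /dg mulrCA -mulrDr; congr (_ * _).
  rewrite mulr_sumr -big_split/=.
  by apply: eq_bigr => i _; rewrite F1lin; ring.
- move=> v; have := lsq_is_derive theta v 0.
  by rewrite scale0r addr0.
Qed.

Section bounds.
Context (q : 'rV[R]_d) (b K0 K1 K2 : R).
Context (K0_ge0 : 0 <= K0) (K1_ge0 : 0 <= K1) (K2_ge0 : 0 <= K2).
Context (F_le : forall z, norm2 (q - z) < b -> l2norm (F^~ z) <= K0).
Context (F1_le : forall u, l2norm (fun i => F1 i u q) <= K1 * norm2 u).
Context (F2_le : forall u v z, norm2 (q - z) < b ->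
  l2norm (fun i => F2 i u v z) <= K2 * norm2 u * norm2 v).

Let K1b := K1 + K2 * b.

(** First derivatives are controlled at the centre [q] only; the bound on second derivatives along
    the segment from [q] to [z] extends this to the ball, at the cost of [K2 * b]. *)
Lemma lsq_first_derivative_le u z : norm2 (q - z) < b ->
  l2norm (fun i => F1 i u z) <= K1b * norm2 u.
Proof.
move=> qz.
have H : l2norm (fun i => F1 i u (q + 1 *: (z - q)) - F1 i u (q + 0 *: (z - q)))
    <= K2 * norm2 u * norm2 (z - q) * 1.
  apply: (@l2norm_increment R I (fun i t => F1 i u (q + t *: (z - q)))
    (fun i t => F2 i u (z - q) (q + t *: (z - q)))) => // t /andP[t0 t1].
  apply: F2_le; rewrite opprD addNKr norm2N norm2Z (gtr0_norm t0).
  apply: le_lt_trans qz; rewrite -(norm2N (q - z)) opprB.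
  by rewrite ler_piMl ?norm2_ge0// ltW.
rewrite scale1r subrKC scale0r addr0 mulr1 in H.
have -> : (fun i => F1 i u z) = (fun i => F1 i u q + (F1 i u z - F1 i u q)).
  by apply/funext => i; rewrite subrKC.
apply: le_trans (l2norm_triangle _ _) _; rewrite mulrDl lerD//.
apply: le_trans H _; rewrite mulrAC ler_wpM2r ?norm2_ge0// ler_wpM2l//.
by rewrite -norm2N opprB ltW.
Qed.

Lemma lsq_derive_le u z : norm2 (q - z) < b ->
  dg u z <= 2 * (K0 * K1b) * norm2 u.
Proof.
move=> qz; rewrite -mulrA ler_pM2l// -mulrA.
apply: le_trans (cauchy_schwarz _ _) _.
by apply: ler_pM; rewrite ?l2norm_ge0 ?F_le ?lsq_first_derivative_le.
Qed.

Lemma lsq_derive2_le u z : norm2 (q - z) < b ->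
  ddg u z <= 2 * (K1b ^+ 2 + K0 * K2) * norm2 u ^+ 2.
Proof.
move=> qz; rewrite -mulrA ler_pM2l// mulrDl big_split/=; apply: lerD.
  rewrite -sqr_l2norm -exprMn ler_sqr ?nnegrE ?l2norm_ge0//.
    exact: lsq_first_derivative_le.
  exact: le_trans (l2norm_ge0 _) (lsq_first_derivative_le u qz).
apply: le_trans (cauchy_schwarz _ _) _; rewrite -mulrA.
apply: ler_pM; rewrite ?l2norm_ge0 ?F_le//.
by rewrite expr2 mulrA F2_le.
Qed.

(** The bound on directional derivatives is applied in the direction [grad g z], where the
    derivative is the squared norm of the gradient; one factor cancels unless the gradient
    vanishes. *)
Lemma lsq_norm2_grad_le z : norm2 (q - z) < b ->
  norm2 (grad g z) <= 2 * (K0 * K1b).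
Proof.
move=> qz; have := lsq_derive_le (grad g z) qz.
rewrite -lsq_dotrv_grad dotrvv expr2.
have := norm2_ge0 (grad g z); rewrite le_eqVlt => /orP[/eqP <- _|N0].
  have b0 : 0 < b by exact: le_lt_trans (norm2_ge0 _) qz.
  by rewrite !mulr_ge0// addr_ge0// mulr_ge0// ltW.
by rewrite ler_pM2r.
Qed.

Lemma lsq_quadratic_upper_bound theta v :
  norm2 (q - theta) + norm2 v < b ->
  g (theta + v) <= g theta + dotrv v (grad g theta) +
    2 * (K1b ^+ 2 + K0 * K2) * norm2 v ^+ 2 / 2.
Proof.
move=> qv; rewrite lsq_dotrv_grad.
have := @quadratic_upper_bound R _ _ _
  (2 * (K1b ^+ 2 + K0 * K2) * norm2 v ^+ 2)
  (lsq_is_derive theta v) (lsq_is_derive2 theta v).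
rewrite scale1r scale0r addr0; apply => t /andP[t0 t1].
apply: lsq_derive2_le; rewrite opprD addrA; apply: le_lt_trans qv.
apply: le_trans (ler_norm2D _ _) _; rewrite lerD2l norm2N norm2Z ger0_norm//.
by rewrite ler_piMl ?norm2_ge0.
Qed.

End bounds.

(** The bounds hold within [2 * b] of [pt theta] while [theta] is within [b]: the margin leaves room
    for the trial steps, of length at most [b / 2], that bound the gradient. *)
Lemma lsq_basin (pt : 'rV[R]_d -> 'rV[R]_d) (P : set 'rV[R]_d)
    (gm b K0 K1 K2 : R) : 0 < b -> 0 <= K0 -> 0 <= K1 -> 0 <= K2 ->
  (forall theta, P theta -> norm2 (pt theta - theta) < b) ->
  (forall theta theta', P theta ->
    norm2 (pt theta - theta') <= norm2 (pt theta - theta) ->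
    P theta' /\ norm2 (pt theta' - theta') <= norm2 (pt theta - theta')) ->
  (forall theta, P theta -> g (pt theta) = gm) ->
  (forall theta z, P theta -> norm2 (pt theta - z) < 2 * b -> gm <= g z) ->
  (forall theta z, P theta -> norm2 (pt theta - z) < 2 * b ->
    l2norm (F^~ z) <= K0) ->
  (forall theta u, P theta ->
    l2norm (fun i => F1 i u (pt theta)) <= K1 * norm2 u) ->
  (forall theta u v z, P theta -> norm2 (pt theta - z) < 2 * b ->
    l2norm (fun i => F2 i u v z) <= K2 * norm2 u * norm2 v) ->
  (forall theta (t : R), P theta -> 0 <= t <= 1 ->
    0 <= ddg (pt theta - theta) (theta + t *: (pt theta - theta))) ->
  exists2 tau0 : R, 0 < tau0 &
    forall tau, 0 < tau <= tau0 -> forall theta0, P theta0 ->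
      g (gradient_descent g tau theta0 n) @[n --> \oo] --> gm.
Proof.
move=> b0 K0p K1p K2p Pb Pstep gpt gm_le F_le F1_le F2_le convex.
pose K1b := K1 + K2 * (2 * b).
pose M := 2 * (K0 * K1b); pose L := 2 * (K1b ^+ 2 + K0 * K2).
have K1bp : 0 <= K1b by rewrite addr_ge0// !mulr_ge0// ltW.
have Mp : 0 <= M by rewrite !mulr_ge0.
have Lp : 0 <= L by rewrite mulr_ge0// addr_ge0 ?sqr_ge0// mulr_ge0.
(* This choice ensures both [s * L <= 1] and [s * M <= b / 2]; the summand 1 keeps the denominator
   positive if [L] and [M] vanish. *)
pose s := (1 + L + M / (b / 2))^-1.
have b20 : 0 < b / 2 by rewrite divr_gt0.
have D0 : 0 < 1 + L + M / (b / 2).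
  by rewrite -addrA ltr_pwDl// addr_ge0// divr_ge0// ltW.
have s0 : 0 < s by rewrite invr_gt0.
have ball2 theta : P theta -> norm2 (pt theta - theta) < 2 * b.
  by move=> /Pb H; apply: lt_trans H _; lra.
exists (2 / s)^-1; first by rewrite invr_gt0 divr_gt0.
apply: (gradient_descent_cvg (pt := pt)) => //.
- by rewrite divr_gt0.
- by move=> theta Pt; apply: (gm_le theta) => //; exact: ball2.
(* Convexity along the segment from [theta] to [pt theta], where [g] takes the value [gm]. *)
- move=> theta Pt; rewrite lsq_dotrv_grad lerBrDl.
  have := convex_above_tangent (lsq_is_derive theta (pt theta - theta))
    (lsq_is_derive2 theta (pt theta - theta)).
  rewrite scale0r addr0 scale1r subrKC gpt//; apply => t t01.
  exact: convex.
- move=> theta Pt.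
  have Fb z := F_le theta z Pt; have F1b u := F1_le theta u Pt.
  have F2b u v z := F2_le theta u v z Pt.
  apply: (@sqr_norm2_grad_le _ _ g theta gm (b / 2) L M) => //.
  + move=> v vb.
    have vb2 : norm2 (pt theta - theta) + norm2 v < 2 * b.
      by have := Pb _ Pt; lra.
    split; last exact: (lsq_quadratic_upper_bound K2p Fb F1b F2b vb2).
    apply: (gm_le theta) => //; apply: le_lt_trans vb2.
    rewrite opprD addrA; apply: le_trans (ler_norm2D _ _) _.
    by rewrite norm2N.
  + exact: (lsq_norm2_grad_le K0p K1p K2p Fb F1b F2b (ball2 _ Pt)).
  + rewrite mulrC ler_pdivrMr// mulrDr (mulrC (b / 2) (M / _)).
    by rewrite divfK ?lt0r_neq0// lerDr mulr_ge0 ?(ltW b20)// addr_ge0.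
  + rewrite mulrC ler_pdivrMr// mul1r -addrA addrCA lerDl addr_ge0//.
    by rewrite divr_ge0// ltW.
Qed.

End least_squares.

(** * Complex columns as real vectors *)

Section complex_parts.
Context {R : realType} {m : nat}.
Implicit Types z w : 'cV[R[i]]_m.

(** These [2 * m] real coordinates turn the complex residual into a real least-squares family. *)
Definition cparts z (i : 'I_m * bool) : R :=
  if i.2 then complex.Re (z i.1 0) else complex.Im (z i.1 0).

Lemma cnorm2E z : cnorm2 z = l2norm (cparts z).
Proof.
congr Num.sqrt; rewrite -(pair_bigA _ (fun i b => cparts z (i, b) ^+ 2))/=.
apply: eq_bigr => i _; rewrite big_bool/= /cparts/=.
by case: (z i 0) => a b /=; rewrite sqr_sqrtr// addr_ge0 ?sqr_ge0.
Qed.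

Lemma cpartsD z w i : cparts (z + w) i = cparts z i + cparts w i.
Proof.
by rewrite /cparts mxE; case: (z i.1 0) => a b; case: (w i.1 0) => a' b'; case: ifP.
Qed.

Lemma cpartsZ (a : R) z i : cparts (a%:C%C *: z) i = a * cparts z i.
Proof.
by rewrite /cparts mxE; case: (z i.1 0) => b c; case: ifP => _ /=; ring.
Qed.

Lemma cpartsB z w i : cparts (z - w) i = cparts z i - cparts w i.
Proof.
rewrite cpartsD; congr (_ + _).
by rewrite /cparts mxE; case: (w i.1 0) => a b; case: ifP.
Qed.

Lemma cnorm2_ge0 z : 0 <= cnorm2 z.
Proof. exact: sqrtr_ge0. Qed.

Lemma ler_cnorm2D z w : cnorm2 (z + w) <= cnorm2 z + cnorm2 w.
Proof.
rewrite !cnorm2E; have -> : cparts (z + w) = (fun i => cparts z i + cparts w i).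
  by apply/funext => i; rewrite cpartsD.
exact: l2norm_triangle.
Qed.

Lemma cnorm2Z (a : R) z : cnorm2 (a%:C%C *: z) = `|a| * cnorm2 z.
Proof.
rewrite !cnorm2E -l2normZ; congr l2norm.
by apply/funext => i; rewrite cpartsZ.
Qed.

Lemma cnorm2N z : cnorm2 (- z) = cnorm2 z.
Proof.
rewrite !cnorm2E -[RHS]mul1r -(normrN1 R) -l2normZ; congr l2norm.
apply/funext => i; rewrite /cparts mxE.
by case: (z i.1 0) => a b; case: ifP; rewrite mulN1r.
Qed.

(** Real and imaginary parts respect differences and are bounded by the modulus, hence are
    1-Lipschitz. *)
Lemma cparts_continuous i :
  continuous (fun z : 'cV[(R[i])^o]_m => cparts z i : R).
Proof.
have ReIm (p : R[i] -> R) : (forall x y, p (x - y) = p x - p y) ->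
    (forall x, `|p x|%:C%C <= `|x|) -> continuous (p : (R[i])^o -> R).
  move=> pB p_le z; have ? : Filter (nbhs (z : (R[i])^o)) by exact: nbhs_filter.
  apply/cvgrPdist_lt => e e0.
  have e0' : (0 : R[i]) < e%:C%C by rewrite ltcR.
  apply: (@filterS _ _ (nbhs_filter z)) (@nbhsx_ballx _ (R[i])^o z _ e0').
  move=> w zw; rewrite -ltcR; apply: le_lt_trans zw.
  by rewrite -pB.
move=> z; apply: (@continuous_comp _ _ _ (fun z : 'cV[(R[i])^o]_m => z i.1 0)
  (fun c : (R[i])^o => if i.2 then complex.Re c else complex.Im c)).
  exact: coord_continuous.
case: i.2.
- apply: (ReIm (@complex.Re R)) => [[a b] [a' b']//|x].
  exact: normc_ge_Re.
- apply: (ReIm (@complex.Im R)) => [[a b] [a' b']//|x].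
  (* Exchanging the two parts preserves the modulus, so the bound on the real part also serves for
     the imaginary part. *)
  case: x => a b; have := normc_ge_Re (b +i* a)%C.
  by rewrite !normc_def/= addrC.
Qed.

End complex_parts.

(** * Distance to the fiber, and constants extracted from suprema *)

Section distance_to_fiber.
Context {R : realType} {D : normedModType R[i]} {d : nat}.
Context (Sigma : set (dual D)) (phi : 'rV[R]_d -> dual D) (thetas : 'rV[R]_d).
Implicit Types theta t : 'rV[R]_d.

Let S := fiber Sigma phi thetas.

Lemma fiber_dist_le theta t : S t ->
  fiber_dist Sigma phi thetas theta <= norm2 (t - theta).
Proof.
move=> St; apply: ge_inf; last by exists t.
by exists 0 => _ [t' _ <-]; exact: norm2_ge0.
Qed.

Lemma fiber_dist_proj theta t : fiber_proj Sigma phi thetas theta t ->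
  fiber_dist Sigma phi thetas theta = norm2 (t - theta).
Proof.
move=> [St tmin]; apply/eqP; rewrite eq_le fiber_dist_le//=.
apply: lb_le_inf; first by exists (norm2 (t - theta)), t.
by move=> _ [t' St' <-]; exact: tmin.
Qed.

End distance_to_fiber.

(** Passes from a supremum over the unit sphere to all directions. *)
Lemma homogeneous_bound (R : realType) (d : nat) (I : finType)
    (f : 'rV[R]_d -> I -> R) (K : R) :
  (forall a u i, f (a *: u) i = a * f u i) ->
  (forall u, norm2 u = 1 -> l2norm (f u) <= K) ->
  forall u, l2norm (f u) <= K * norm2 u.
Proof.
move=> fZ fK u; have fZ' a v : l2norm (f (a *: v)) = `|a| * l2norm (f v).
  by rewrite -l2normZ; congr l2norm; apply/funext => i.
have := norm2_ge0 u; rewrite le_eqVlt => /orP[/eqP/esym u0|u0].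
  by rewrite u0 mulr0 (norm2_eq0 u0) -[X in f X](scale0r 0) fZ' normr0 mul0r.
have {1}-> : u = norm2 u *: ((norm2 u)^-1 *: u).
  by rewrite scalerA mulfV ?lt0r_neq0// scale1r.
rewrite fZ' mulrC gtr0_norm// ler_pM2r// fK// norm2Z.
by rewrite gtr0_norm ?invr_gt0// mulVf// lt0r_neq0.
Qed.

Lemma is_derive_real (R : realType) (k : R -> R) (t l : R) :
  (fun h => h^-1 * (k (t + h) - k t)) @ 0^' --> l ->
  is_derive t (1 : R) k l.
Proof.
move=> kl.
have E : (fun h : R => h^-1 *: ((k \o shift t) (h *: 1) - k t)) =
    (fun h => h^-1 * (k (t + h) - k t)).
  by apply/funext => h /=; rewrite [h *: 1]mulr1 (addrC t).
split; first by rewrite /derivable E; apply/cvg_ex; exists l.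
by rewrite /derive E; exact/cvg_lim.
Qed.

(** The value [-oo] has to be covered: it is the supremum over unit vectors in dimension 0. *)
Lemma ereal_bound (R : realType) (M : \bar R) : (M < +oo)%E ->
  exists2 K : R, 0 <= K & forall x : R, (x%:E <= M)%E -> x <= K.
Proof.
case: M => [r _|//|_].
- exists `|r| => // x; rewrite lee_fin => xr.
  exact: le_trans xr (ler_norm _).
- by exists 0.
Qed.

(** * Weak-* derivatives seen through [A] *)

Section weak_star_derivatives.
Context {R : realType} {D : normedModType R[i]} {d m : nat}.
Context (A : {linear dual D -> 'cV[R[i]]_m}).
Context (A_cont : continuous (A : dual D -> 'cV[(R[i])^o]_m)).
Implicit Types (f phi : 'rV[R]_d -> dual D) (theta u v : 'rV[R]_d).

Lemma cvg_cparts {T : Type} {G : set_system T} {fG : Filter G}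
    (f : T -> dual D) (x : dual D) i :
  f @ G --> x -> cparts (A (f t)) i @[t --> G] --> cparts (A x) i.
Proof.
move=> fx; apply: (@cvg_comp _ _ _ f (fun z => cparts (A z) i) G _ _ fx).
apply: (@continuous_comp _ _ _ (A : dual D -> 'cV[(R[i])^o]_m)
  (fun z : 'cV[(R[i])^o]_m => cparts z i)).
  exact: A_cont.
exact: cparts_continuous.
Qed.

Lemma cparts_diff_quotient f theta u h i :
  cparts (A (diff_quotient f theta u h)) i =
  h^-1 * (cparts (A (f (theta + h *: u))) i - cparts (A (f theta)) i).
Proof. by rewrite /diff_quotient linearZ/= linearB/= cpartsZ cpartsB. Qed.

Lemma ws_derive_cvg f theta u : ws_differentiable f theta ->
  diff_quotient f theta u h @[h --> 0^'] --> ws_derive f u theta.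
Proof. by move=> [L /(_ u) fL]; exact: (cvgP _ fL). Qed.

(** The chosen limit [ws_derive] and the linear map of the definition are compared after applying
    [A], by uniqueness of real limits. *)
Lemma cparts_ws_derive f theta : ws_differentiable f theta ->
  exists L : {linear 'rV[R]_d -> dual D | real_complex R \; *:%R},
    forall u i, cparts (A (ws_derive f u theta)) i = cparts (A (L u)) i.
Proof.
move=> fd; have [L fL] := fd; exists L => u i.
exact: (cvg_unique (@norm_hausdorff R R)
  (cvg_cparts (ws_derive_cvg (u := u) fd)) (cvg_cparts (fL u))).
Qed.

Lemma cparts_ws_deriveZ f theta (a : R) u i : ws_differentiable f theta ->
  cparts (A (ws_derive f (a *: u) theta)) i =
  a * cparts (A (ws_derive f u theta)) i.
Proof.
by move=> /cparts_ws_derive[L E]; rewrite !E linearZ/= linearZ/= cpartsZ.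
Qed.

Lemma cparts_ws_deriveD f theta u v i : ws_differentiable f theta ->
  cparts (A (ws_derive f (u + v) theta)) i =
  cparts (A (ws_derive f u theta)) i + cparts (A (ws_derive f v theta)) i.
Proof.
by move=> /cparts_ws_derive[L E]; rewrite !E linearD/= linearD/= cpartsD.
Qed.

Lemma is_derive_cparts f theta u (t : R) i :
  ws_differentiable f (theta + t *: u) ->
  is_derive t (1 : R) (fun s => cparts (A (f (theta + s *: u))) i)
    (cparts (A (ws_derive f u (theta + t *: u))) i).
Proof.
move=> /(ws_derive_cvg (u := u)) fd; apply: is_derive_real.
apply: cvg_trans (cvg_cparts (i := i) fd); apply: near_eq_cvg; near=> h.
by rewrite cparts_diff_quotient scalerDl addrA.
Unshelve. all: by end_near. Qed.

(** Differentiability of [ws_derive phi u] gives linearity in the outer direction [v] only. For the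
    inner direction, the derivatives of [phi] along [a *: u] and [u] have proportional coordinates
    under [A] at every point, so the same holds after differentiating along [v]. *)
Lemma cparts_ws_derive2Z phi theta (a : R) u v i :
  ws_twice_differentiable phi ->
  cparts (A (ws_derive (ws_derive phi (a *: u)) v theta)) i =
  a * cparts (A (ws_derive (ws_derive phi u) v theta)) i.
Proof.
move=> [phi1 phi2].
have H w := is_derive_cparts (t := 0) i (phi2 w (theta + 0 *: v)).
have := H (a *: u); have /(is_deriveZ a) := H u.
have -> : a \*: (fun s => cparts (A (ws_derive phi u (theta + s *: v))) i) =
    (fun s => cparts (A (ws_derive phi (a *: u) (theta + s *: v))) i).
  by apply/funext => s; rewrite cparts_ws_deriveZ.
rewrite scale0r addr0.
by move=> [_ E1] [_ E2]; rewrite -E2 E1.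
Qed.

End weak_star_derivatives.

(** * The lower RIP bound for derivatives of the parametrization *)

Section restricted_isometry.
Context {R : realType} {D : normedModType R[i]} {H : normedModType R}.
Context {d m : nat}.
Context (A : {linear dual D -> 'cV[R[i]]_m}).
Context (A_cont : continuous (A : dual D -> 'cV[(R[i])^o]_m)).
Context (Sigma : set (dual D)) (iota : dual D -> H).
Context (iota_lin : contained_in_Hilbert Sigma iota).
Context (gamma : R) (gamma_lt1 : 0 <= gamma < 1).
Context (A_RIP : RIP A iota (secant Sigma) gamma).
Context (phi : 'rV[R]_d -> dual D).
Implicit Types (x y : dual D) (theta u z : 'rV[R]_d).

Lemma iotaB x y : Sigma x -> Sigma y -> iota (x - y) = iota x - iota y.
Proof.
move=> Sx Sy; have [_ /(_ _ _ Sx Sy 1 (-1))] := iota_lin.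
by rewrite (rmorph1 (real_complex R)) rmorphN1 !scale1r !scaleN1r.
Qed.

Lemma RIP_upper x y : Sigma x -> Sigma y ->
  cnorm2 (A (x - y)) <= Num.sqrt (1 + gamma) * `|iota (x - y)|.
Proof.
move=> Sx Sy.
have /andP[_ AR] := A_RIP (ex_intro2 _ _ _ Sx (ex_intro2 _ _ _ Sy erefl)).
have g0 : 0 <= 1 + gamma by have /andP[+ _] := gamma_lt1; lra.
rewrite -ler_sqr ?nnegrE ?cnorm2_ge0 ?mulr_ge0 ?sqrtr_ge0//.
by rewrite exprMn (sqr_sqrtr g0).
Qed.

(** A difference quotient is [h^-1] times a secant, and both sides are homogeneous of degree 2. The
    scalar is moved through [iota] by means of the combination with coefficients [h^-1] and
    [- h^-1]. *)
Lemma RIP_diff_quotient z u (h : R) : Sigma (phi z) -> Sigma (phi (z + h *: u)) ->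
  (1 - gamma) * `|iota (diff_quotient phi z u h)| ^+ 2 <=
  cnorm2 (A (diff_quotient phi z u h)) ^+ 2.
Proof.
move=> Sz Szh.
have -> : iota (diff_quotient phi z u h) =
    h^-1 *: iota (phi (z + h *: u) - phi z).
  have [_ /(_ _ _ Szh Sz h^-1 (- h^-1))] := iota_lin.
  by rewrite rmorphN/= scaleNr -scalerBr => ->; rewrite iotaB// scaleNr scalerBr.
rewrite linearZ/= cnorm2Z normrZ !exprMn mulrCA ler_wpM2l ?sqr_ge0//.
by have /andP[] := A_RIP (ex_intro2 _ _ _ Szh (ex_intro2 _ _ _ Sz erefl)).
Qed.

(** Limit of the inequality for difference quotients: the left side converges by the compatibility
    assumption, the right side by continuity of [A]. *)
Lemma RIP_derive z u : open (Theta Sigma phi) -> compatible_normH Sigma iota phi ->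
  ws_differentiable phi z -> Sigma (phi z) ->
  (1 - gamma) * deriv_normH iota phi z u ^+ 2 <=
  cnorm2 (A (ws_derive phi u z)) ^+ 2.
Proof.
move=> Topen compat phid Sz.
have /getPex := compat z u Sz; rewrite -/(deriv_normH iota phi z u) /=.
set l := deriv_normH _ _ _ _ => hl.
(* A positive null sequence satisfies [h n = |h n|], which is the form of the steps in the
   compatibility assumption. *)
pose h (n : nat) : R := harmonic n.
have h0 n : 0 < h n by rewrite /h /= invr_gt0.
have hE n : `|h n| = h n by rewrite gtr0_norm.
have hcvg : h @ \oo --> (0 : R) by exact: cvg_harmonic.
have {}hl : `|iota (diff_quotient phi z u (h n))| @[n --> \oo] --> l.
  under eq_fun do rewrite -hE.
  apply: hl => [n|]; first exact: lt0r_neq0 (h0 n).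
  by under eq_fun do rewrite hE.
have hdn : h @ \oo --> (0 : R)^'.
  move=> S S0; suff : \forall n \near \oo, S (h n) by [].
  near=> n; have : h n != 0 -> S (h n) by near: n; exact: hcvg _ S0.
  by apply; exact: lt0r_neq0 (h0 n).
have Acvg : cnorm2 (A (diff_quotient phi z u (h n))) ^+ 2 @[n --> \oo] -->
    cnorm2 (A (ws_derive phi u z)) ^+ 2.
  rewrite cnorm2E sqr_l2norm.
  under eq_fun do rewrite cnorm2E sqr_l2norm.
  apply: cvg_big => [|i _]; first exact: add_continuous.
  have c : cparts (A (diff_quotient phi z u (h n))) i @[n --> \oo] -->
      cparts (A (ws_derive phi u z)) i.
    apply: (cvg_cparts A_cont).
    apply: (@cvg_comp _ _ _ h (diff_quotient phi z u) _ _ _ hdn).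
    exact: ws_derive_cvg.
  by under eq_fun do rewrite expr2; rewrite expr2; exact: cvgM.
(* Openness of [Theta] puts the nearby points [phi (z + h n *: u)] in [Sigma], so that the
   differences are secants. *)
have Scvg : \forall n \near \oo, Sigma (phi (z + h n *: u)).
  have : z + h n *: u @[n --> \oo] --> z + 0 *: u.
    by apply: cvgD; [exact: cvg_cst|exact: (cvgZ hcvg (cvg_cst u))].
  rewrite scale0r addr0.
  by move=> zc; exact: (zc _ (open_nbhs_nbhs (conj Topen Sz))).
have Icvg : (1 - gamma) * `|iota (diff_quotient phi z u (h n))| ^+ 2
    @[n --> \oo] --> (1 - gamma) * l ^+ 2.
  apply: cvgMr; rewrite expr2; under eq_fun do rewrite expr2.
  exact: (cvgM hl hl).
apply: (ler_cvg_to Icvg Acvg).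
near=> n; apply: RIP_diff_quotient => //.
by near: n.
Unshelve. all: by end_near. Qed.

End restricted_isometry.

(** * The tube around the fiber: residual bound, stability and convexity *)

Theorem corollary2p1 (R : realType) (D : completeNormedModType R[i])
    (H : completeNormedModType R) (dotH : {dot H for idfun})
    (hH : forall x : H, `|x| ^+ 2 = dotH x x)
    (d m : nat)
    (Sigma : set (dual D)) (hcone : is_cone Sigma)
    (iota : dual D -> H) (hiota : contained_in_Hilbert Sigma iota)
    (A : {linear dual D -> 'cV[R[i]]_m})
    (hAcont : continuous (A : dual D -> 'cV[(R[i])^o]_m))
    (alpha : 'I_m -> D) (hAform : forall (x : dual D) (l : 'I_m), A x l 0 = x (alpha l))
    (gamma : R) (hgamma : 0 <= gamma < 1)
    (hRIP : RIP A iota (secant Sigma) gamma)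
    (phi : 'rV[R]_d -> dual D) (hparam : parametrizes Sigma phi)
    (hphicont : continuous phi) (hphidiff : ws_twice_differentiable phi)
    (hTheta : open (Theta Sigma phi))
    (hcompat : compatible_normH Sigma iota phi)
    (x0 : dual D) (hx0 : Sigma x0) (e y : 'cV[R[i]]_m) (hy : y = A x0 + e)
    (g : 'rV[R]_d -> R) (hg : forall theta, g theta = cnorm2 (A (phi theta) - y) ^+ 2)
    (thetas : 'rV[R]_d) (hthetas : is_global_min g (Theta Sigma phi) thetas)
    (beta1 : R) (hbeta1 : 0 < beta1)
    (ptilde : 'rV[R]_d -> 'rV[R]_d)
    (hptilde : forall theta, Lambda Sigma phi thetas (2 * beta1)%:E theta ->
       fiber_proj Sigma phi thetas theta = [set ptilde theta])
    (C : R) (M1 M2 : \bar R)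
    (htech : technical_assumption A Sigma iota phi thetas beta1 C M1 M2)
    (beta2 : \bar R)
    (hbeta2 : beta2 =
       (((1 - gamma) / (C * Num.sqrt (1 + gamma)))%:E
          * inf_curvature A Sigma iota phi thetas beta1 ptilde
        - (1 / (C * Num.sqrt (1 + gamma)) * cnorm2 e)%:E)%E)
    (hbeta2_gt0 : (0 < beta2)%E) :
  basin_of_attraction g (Lambda Sigma phi thetas (Order.min beta1%:E beta2)) thetas.
Proof.
have [thS gmin] := hthetas.
have [tech1 [C0 tech2] [M1E M1fin] [M2E M2fin]] := htech.
have [K1 K1_ge0 K1P] := ereal_bound M1fin.
have [K2 K2_ge0 K2P] := ereal_bound M2fin.
have /andP[gamma0 gamma1] := hgamma.
have [phi1 phi2] := hphidiff.
set s1 := Num.sqrt (1 + gamma) in hbeta2.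
have s10 : 0 < s1 by rewrite sqrtr_gt0; lra.
pose dist := fiber_dist Sigma phi thetas.
have dist_thetas : dist thetas <= 0.
  by rewrite -(@norm20 R d) -(subrr thetas); exact: fiber_dist_le.
have e_ge0 := cnorm2_ge0 e.
(* A parameter [theta0] of [x0] has residual [- e], and the global minimizer does at least as
   well. *)
have res_thetas : cnorm2 (A (phi thetas) - y) <= cnorm2 e.
  have [theta0 _ phi0] := hparam _ hx0.
  rewrite -ler_sqr ?nnegrE ?cnorm2_ge0// -hg; apply: le_trans (gmin theta0 _) _.
    by rewrite /Theta /= phi0.
  by rewrite hg phi0 hy opprD addNKr cnorm2N.
have in_Lambda z : dist z < 2 * beta1 -> Lambda Sigma phi thetas (2 * beta1)%:E z.
  by move=> dz; split; [exact: tech1|rewrite lte_fin].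
(* The upper RIP bound on the secant [phi z - phi thetas] is combined with the second clause of the
   technical assumption. *)
have residual z : dist z < 2 * beta1 ->
    cnorm2 (A (phi z) - y) <= C * s1 * dist z + cnorm2 e.
  move=> dz.
  have -> : A (phi z) - y = A (phi z - phi thetas) + (A (phi thetas) - y).
    by rewrite linearB/= addrA subrK.
  apply: le_trans (ler_cnorm2D _ _) _; apply: lerD => //.
  apply: le_trans (RIP_upper hgamma hRIP (tech1 _ dz) thS) _.
  by rewrite (mulrC C) -mulrA ler_pM2l//; apply: tech2; exact: in_Lambda.
pose P := Lambda Sigma phi thetas (Order.min beta1%:E beta2).
have P_beta theta : P theta -> dist theta < beta1 /\ ((dist theta)%:E < beta2)%E.
  by move=> [_]; rewrite lt_min lte_fin => /andP[].
have P_proj theta : P theta -> fiber_proj Sigma phi thetas theta (ptilde theta).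
  move=> /P_beta[db _]; rewrite hptilde//; apply: in_Lambda.
  by apply: lt_trans db _; lra.
have P_dist theta : P theta -> dist theta = norm2 (ptilde theta - theta).
  by move=> /P_proj/fiber_dist_proj.
have P_fiber theta : P theta -> fiber Sigma phi thetas (ptilde theta).
  by move=> /P_proj[].
have dist_le theta z : P theta -> dist z <= norm2 (ptilde theta - z).
  by move=> /P_fiber; exact: fiber_dist_le.
pose F i theta := cparts (A (phi theta) - y) i.
pose F1 i u theta := cparts (A (ws_derive phi u theta)) i.
pose F2 i u v theta := cparts (A (ws_derive (ws_derive phi u) v theta)) i.
have gF theta : g theta = \sum_i F i theta ^+ 2.
  by rewrite hg cnorm2E sqr_l2norm.
split.
  split => //; apply: (@le_lt_trans _ _ 0%E); first by rewrite lee_fin.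
  by rewrite lt_min lte_fin hbeta1.
have FD i theta u (t : R) : is_derive t (1 : R)
    (fun s => F i (theta + s *: u)) (F1 i u (theta + t *: u)).
  have := is_deriveB (is_derive_cparts hAcont i (phi1 (theta + t *: u)))
    (is_derive_cst (cparts y i) t (1 : R)).
  rewrite subr0; congr is_derive.
  by apply/funext => s; rewrite /F cpartsB.
have -> : g = fun theta => \sum_i F i theta ^+ 2 by exact/funext.
(* The constant for [F] is the residual bound at distance [2 * beta1] from the fiber; [K1] and [K2]
   come from [M1] and [M2]. *)
apply: (@lsq_basin _ _ _ F F1 F2 FD _ _ ptilde P _ beta1
  (C * s1 * (2 * beta1) + cnorm2 e) K1 K2) => //.
- by move=> i u theta v t; apply: is_derive_cparts => //; exact: phi2.
- move=> i theta a u v.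
  by rewrite /F1 cparts_ws_deriveD// cparts_ws_deriveZ.
- by rewrite addr_ge0// !mulr_ge0// ltW.
- by move=> theta Pt; rewrite -P_dist//; have [] := P_beta _ Pt.
(* The distance of [theta'] to the fiber is at most that of [theta], so both strict bounds persist;
   the first clause of the technical assumption puts [theta'] in [Theta]. *)
- move=> theta theta' Pt le_d.
  have le_d' : dist theta' <= dist theta.
    by rewrite (P_dist theta)//; apply: le_trans le_d; exact: dist_le.
  have [d1 d2] := P_beta _ Pt.
  have Pt' : P theta'.
    split; first by apply: tech1; apply: le_lt_trans le_d' _; lra.
    by rewrite lt_min lte_fin (le_lt_trans le_d' d1)/= (le_lt_trans _ d2)// lee_fin.
  by split => //; rewrite -P_dist//; exact: dist_le.
- by move=> theta /P_fiber[_ pE]; rewrite /= -!gF !hg pE.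
(* The tube of radius [2 * beta1] lies in [Theta], on which [thetas] minimizes [g]. *)
- move=> theta z Pt tz; rewrite /= -!gF.
  apply: gmin; apply: tech1; exact: le_lt_trans (dist_le _ _ Pt) tz.
- move=> theta z Pt tz; rewrite -cnorm2E.
  have dz := le_lt_trans (dist_le _ _ Pt) tz.
  apply: le_trans (residual z dz) _; rewrite lerD2r ler_pM2l ?mulr_gt0//.
  exact: ltW.
- move=> theta u /P_fiber[_ pE].
  apply: (@homogeneous_bound _ _ _ (fun u i => F1 i u (ptilde theta))).
    by move=> a v i; exact: cparts_ws_deriveZ.
  move=> v v1; rewrite -cnorm2E; apply: K1P; rewrite M1E.
  apply: le_trans (_ : _ <= ereal_sup _)%E (ereal_sup_ubound _); last first.
    by exists (ptilde theta).
  by apply: ereal_sup_ubound; exists v.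
- move=> theta u v z Pt tz.
  have dz := le_lt_trans (dist_le _ _ Pt) tz.
  apply: (@homogeneous_bound _ _ _ (fun v i => F2 i u v z)) => {v}.
    by move=> a v i; exact: cparts_ws_deriveZ.
  move=> v v1; apply: (@homogeneous_bound _ _ _ (fun u i => F2 i u v z)) => {u}.
    by move=> a u i; exact: cparts_ws_derive2Z.
  move=> u u1; rewrite -cnorm2E; apply: K2P; rewrite M2E.
  apply: le_trans (_ : _ <= ereal_sup _)%E (ereal_sup_ubound _); last first.
    by exists z => //; exact: in_Lambda.
  by apply: ereal_sup_ubound; exists (u, v).
(* Convexity: the squared first derivative, bounded below by the RIP, has to dominate the product of
   the residual with the second derivative. *)
- move=> theta t Pt /andP[t0 t1].
  set u := ptilde theta - theta; set z := theta + t *: u.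
  have [d1 d2] := P_beta _ Pt.
  (* Moving towards the projection shrinks the distance by the factor [1 - t], so the residual bound
     at [theta] also holds at [z]. *)
  have dz : dist z <= dist theta.
    apply: le_trans (dist_le theta z Pt) _; rewrite (P_dist theta)// -/u.
    have -> : ptilde theta - z = (1 - t) *: u.
      by rewrite scalerBl scale1r /z opprD addrA.
    by rewrite norm2Z ler_piMl ?norm2_ge0// ger0_norm; lra.
  have dz2 : dist z < 2 * beta1 by apply: le_lt_trans dz _; lra.
  have := RIP_derive hAcont hiota hRIP u hTheta hcompat (phi1 z) (tech1 _ dz2).
  set n := deriv_normH _ _ _ _ => rip.
  have resz : cnorm2 (A (phi z) - y) <= C * s1 * dist theta + cnorm2 e.
    apply: le_trans (residual z dz2) _.
    by rewrite lerD2r ler_pM2l ?mulr_gt0.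
  rewrite mulr_ge0// big_split/=.
  set q := cnorm2 (A (ws_derive (ws_derive phi u) u z)).
  have q0 : 0 <= q by exact: cnorm2_ge0.
  have FF2 : - (cnorm2 (A (phi z) - y) * q) <= \sum_i F i z * F2 i u u z.
    by rewrite /q !cnorm2E; exact: cauchy_schwarzN.
  have -> : \sum_i F1 i u z ^+ 2 = cnorm2 (A (ws_derive phi u z)) ^+ 2.
    by rewrite cnorm2E sqr_l2norm.
  suff : cnorm2 (A (phi z) - y) * q <= (1 - gamma) * n ^+ 2 by lra.
  (* For [q = 0] the quotient is [+oo] and carries no information, but the inequality is then
     trivial. *)
  have [qE|qN] := eqVneq q 0.
    by rewrite qE mulr0 mulr_ge0 ?sqr_ge0//; lra.
  have {}q0 : 0 < q by rewrite lt_neqAle eq_sym qN.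
  apply: le_trans (_ : (C * s1 * dist theta + cnorm2 e) * q <= _).
    by rewrite ler_pM2r.
  have curv : (inf_curvature A Sigma iota phi thetas beta1 ptilde <=
      (n ^+ 2 / q)%:E)%E.
    apply: le_trans (_ : _ <= ereal_inf _)%E _.
      apply: ereal_inf_lbound; exists theta => //.
      by split; [have [] := Pt|rewrite lte_fin].
    apply: ereal_inf_lbound; exists z.
      exists t; first by rewrite /= in_itv/= t0.
      by rewrite /z /u scalerBl scale1r scalerBr addrAC addrA.
    by rewrite /curvature_ratio -/q (negbTE qN).
  have Cs0 : 0 < C * s1 by rewrite mulr_gt0.
  (* The infimum in [beta2] is at most the quotient at [z]; clearing denominators in
     [dist theta < beta2] yields the inequality sought. *)
  have : dist theta <
      (1 - gamma) / (C * s1) * (n ^+ 2 / q) - 1 / (C * s1) * cnorm2 e.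
    rewrite -lte_fin; apply: lt_le_trans d2 _; rewrite hbeta2 EFinB.
    apply: leeB => //; rewrite [leRHS]EFinM; apply: lee_wpmul2l => //.
    by rewrite lee_fin divr_ge0 ?(ltW Cs0)//; lra.
  have -> : (1 - gamma) / (C * s1) * (n ^+ 2 / q) - 1 / (C * s1) * cnorm2 e =
     ((1 - gamma) * n ^+ 2 / q - cnorm2 e) / (C * s1).
    by field; rewrite qN !lt0r_neq0.
  rewrite ltr_pdivlMr// ltrBrDr ltr_pdivlMr// => /ltW.
  by rewrite (mulrC (dist theta)).
Qed.
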